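(* Let $m\ge 3$ be an integer. Let $u=\alpha\sigma_m(u')\beta$ and $v=\alpha'\sigma_m(v')\beta'$ be two factors of the generalized Thue-Morse word $\mathbf{t}_m$, where $u',v'\in\Sigma_m^*$, $(\alpha,\beta),(\alpha',\beta')\in\mathcal{S}\times\mathcal{P}$ and $\min\{|u'|,|v'|\}\ge 3$. Then $u\sim_2 v$ if and only if $\alpha=\alpha'$, $\beta=\beta'$ and $u'\sim_1 v'$.
   Context: Let $\Sigma_m=\{0,1,\dots,m-1\}$, let $\Sigma_m^*$ be the set of finite words over $\Sigma_m$ (including the empty word $\varepsilon$), and let $|w|$ denote the length of $w$. The morphism $\sigma_m:\Sigma_m^*\to\Sigma_m^*$ is defined on letters by $\sigma_m(a)=a(a+1)\cdots(a+m-1)$, each letter reduced modulo $m$ to an element of $\Sigma_m$ (so $0\mapsto 01\cdots(m-1)$, $1\mapsto 12\cdots(m-1)0$, etc.). The generalized Thue-Morse word $\mathbf{t}_m=\sigma_m^\infty(0)$ is the infinite fixed point of $\sigma_m$ beginning with $0$. A factor is a finite block of consecutive letters. Define $$\mathcal{S}=\{w\in\Sigma_m^*: w\text{ is a suffix of }\sigma_m(a)\text{ for some }a\in\Sigma_m,\ |w|<m\},$$ $$\mathcal{P}=\{w\in\Sigma_m^*: w\text{ is a prefix of }\sigma_m(a)\text{ for some }a\in\Sigma_m,\ |w|<m\}$$ (both contain $\varepsilon$). For finite words $u,x$, the binomial coefficient $\binom{u}{x}$ is the number of occurrences of $x$ as a (not necessarily contiguous) subsequence of $u$, i.e. the number of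 index sequences $i_1<\cdots<i_{|x|}$ such that reading $u$ at these positions gives $x$; $\binom{u}{\varepsilon}=1$. For $k\ge1$, $u\sim_k v$ ($k$-binomial equivalence) means $\binom{u}{x}=\binom{v}{x}$ for all words $x$ over the alphabet of length at most $k$. In particular $u\sim_1 v$ means each letter occurs equally often in $u$ and $v$. *)

(* Defs.v *)
From mathcomp Require Import all_boot all_algebra.

Set Implicit Arguments.
Unset Strict Implicit.
Unset Printing Implicit Defensive.

Import GRing.Theory.

Section BinomialEquivalence.

Variable T : eqType.
Implicit Types u v x : seq T.

(* Counts the strictly increasing index sequences i_1 < ... < i_|x| along which
   u reads x.  For x = [::] the only one is the empty sequence. *)
Definition wbinom u x : nat :=
  #|[set i : (size x).-tuple 'I_(size u) |
      sorted ltn (map val i) & map (tnth (in_tuple u)) i == x]|.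

Definition kbinom_eq (k : nat) u v : Prop :=
  forall x, size x <= k -> wbinom u x = wbinom v x.

End BinomialEquivalence.

Section ThueMorse.

(* The alphabet {0, ..., m-1} is the ring 'Z_m, so letters are added modulo m;
   'Z_m has m elements only when 1 < m. *)
Variable m : nat.
Implicit Types (a : 'Z_m) (w : seq 'Z_m).

Definition tm_letter a : seq 'Z_m := mkseq (fun i => a + i%:R)%R m.

Definition tm_morph w : seq 'Z_m := flatten (map tm_letter w).

(* As tm_letter 0 begins with 0, each iterate of tm_morph on [:: 0] is a prefix
   of the next.  For 1 < m the n-th iterate has length m ^ n > n, so the default
   value of nth is never reached. *)
Definition thue_morse (n : nat) : 'Z_m :=
  nth 0%R (iter n tm_morph [:: 0%R]) n.

Definition tm_factor w : Prop :=
  exists i, w = mkseq (fun j => thue_morse (i + j)) (size w).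

Definition tm_suffix w : Prop :=
  (exists a, suffix w (tm_letter a)) /\ size w < m.

Definition tm_prefix w : Prop :=
  (exists a, prefix w (tm_letter a)) /\ size w < m.

End ThueMorse.

(* Main.v *)
Require Import Defs.
From mathcomp Require Import all_boot all_algebra.
From mathcomp Require Import zify.

Set Implicit Arguments.
Unset Strict Implicit.
Unset Printing Implicit Defensive.

Import GRing.Theory.

(** Write n = |u'| and n' = |v'|.  Every block of a morphic image contains each
letter once, so letters are told apart only by the ends alpha and beta and, for
pairs of letters, by the order inside the blocks.  Let A and B be the indicator
functions of the letters of alpha and beta; both words are proper runs
x, x + 1, x + 2, and so on, of fewer than m letters.  For a letter a and its
successor b = a + 1 the order inside a block is b before a only in the block
that starts with b, whence ([subpairs_decomp])

  |u|_ab = A(a)A(b) + B(a)B(b) + A(a)B(b) + n(A(a) + B(b))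
           + (n - |u'|_b) + n(n - 1)/2.

This formula, together with |u|_c = n + A(c) + B(c), is all that is used of
2-binomial equivalence.

Comparing u and v on a pair a, a + 1 is a finite problem: unless u' or v' is a
power of the letter a + 1, the differences A - A' and B - B' take the same value
at a and at a + 1 ([adjacent_letters_agree]).  Such powers cannot occur:
three equal consecutive blocks would be 3m consecutive letters of the Thue-Morse
word, each the successor of the one before, and desubstituting once gives three
equal consecutive letters, of which two lie in a common block
([thue_morse_no_long_run]).  So A - A' and B - B' are constant around the
alphabet.  As proper runs omit a letter, the constants are 0, and a proper run
is determined by its letters, so alpha = alpha' and beta = beta'
([run_inj_step]).  Then n = n', and the formula gives |u'|_b = |v'|_b for all b.

Conversely the number of occurrences of a pair in an image is a sum over its
blocks plus a term that depends on the number of blocks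
([subpairs_tm_morph]), so it is invariant under permuting the preimage. *)

(** * Occurrences of one and two letters *)

Fixpoint subpairs (T : eqType) (a b : T) (w : seq T) : nat :=
  if w is c :: w' then (c == a) * count_mem b w' + subpairs a b w' else 0.

Lemma wbinom_nil (T : eqType) (u : seq T) : wbinom u [::] = 1.
Proof.
rewrite /wbinom /= (eq_card (B := predT)) ?card_tuple //.
by move=> i; rewrite inE tuple0.
Qed.

Lemma sum_tnth_eq (T : eqType) (u : seq T) (a : T) :
  \sum_(i < size u) (tnth (in_tuple u) i == a) = count_mem a u.
Proof.
rewrite -sum1_count [RHS]big_tnth [RHS]big_mkcond /=.
by apply: eq_bigr => i _; case: eqP.
Qed.

Lemma wbinom_letter (T : eqType) (u : seq T) (a : T) :
  wbinom u [:: a] = count_mem a u.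
Proof.
rewrite /wbinom -sum1dep_card /=.
rewrite (reindex (fun i : 'I_(size u) => [tuple i])) /=; last first.
  apply: onW_bij; exists (fun t => thead t); first by move=> i.
  by move=> t; case/tupleP: t => x t; apply/val_inj; rewrite /= [t]tuple0.
rewrite -sum_tnth_eq big_mkcond; apply: eq_bigr => i _ /=.
by rewrite eqseq_cons eqxx andbT; case: eqP.
Qed.

(** Splitting on the first letter: a pair either uses position 0, which leaves an
occurrence of the second letter in the tail, or lies in the tail. *)
Lemma wbinom_pair (T : eqType) (u : seq T) (a b : T) :
  wbinom u [:: a; b] = subpairs a b u.
Proof.
rewrite /wbinom -sum1dep_card /=.
rewrite (reindex (fun p : 'I_(size u) * 'I_(size u) => [tuple p.1; p.2])) /=;
  last first.
  apply: onW_bij; exists (fun t => (tnth t ord0, tnth t (lift ord0 ord0))).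
    by case.
  move=> t; case/tupleP: t => x t; case/tupleP: t => y t.
  by apply/val_inj; rewrite /= [t]tuple0.
transitivity (\sum_(i < size u) \sum_(j < size u)
    nat_of_bool [&& i < j, tnth (in_tuple u) i == a & tnth (in_tuple u) j == b]).
  rewrite pair_bigA /= big_mkcond; apply: eq_bigr => -[i j] _ /=.
  by rewrite !eqseq_cons eqxx !andbT; case: ifP.
elim: u => [|c u IHu]; first by rewrite big_ord0.
rewrite /= big_ord_recl big_ord_recl /= add0n; congr addn.
  rewrite -sum_tnth_eq big_distrr /=.
  by apply: eq_bigr => j _; rewrite !(tnth_nth c) /=; case: eqP; case: eqP.
rewrite -IHu; apply: eq_bigr => i _; rewrite big_ord_recl /= add0n.
by apply: eq_bigr => j _; rewrite !(tnth_nth c).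
Qed.

Lemma subpairs_cat (T : eqType) (a b : T) (u v : seq T) :
  subpairs a b (u ++ v)
  = subpairs a b u + subpairs a b v + count_mem a u * count_mem b v.
Proof. by elim: u => [|c u IHu] /=; rewrite ?IHu ?count_cat; lia. Qed.

Lemma kbinom_eq1E (T : eqType) (u v : seq T) :
  kbinom_eq 1 u v <-> perm_eq u v.
Proof.
split=> [uv | /permP uv].
  by apply/allP => a _ /=; rewrite -!wbinom_letter; apply/eqP/uv.
by case=> [|a [|//]] _; rewrite ?wbinom_nil // !wbinom_letter uv.
Qed.

Lemma kbinom_eq2E (T : eqType) (u v : seq T) :
  kbinom_eq 2 u v <->
  (forall a, count_mem a u = count_mem a v) /\
  (forall a b, subpairs a b u = subpairs a b v).
Proof.
split=> [uv | [uv1 uv2]].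
  by split=> [a|a b]; rewrite -?wbinom_letter -?wbinom_pair; apply: uv.
case=> [|a [|b [|//]]] _; rewrite ?wbinom_nil //.
  by rewrite !wbinom_letter.
by rewrite !wbinom_pair.
Qed.

(** * Cyclic runs of letters *)

(** With s = m this is the block of x; a proper suffix or prefix of a block is a
run with s < m, which treats both ends of a factor alike. *)
Definition run (m : nat) (x : 'Z_m) (s : nat) : seq 'Z_m :=
  mkseq (fun i => x + i%:R)%R s.

Lemma run_add (m : nat) (x : 'Z_m) (s t : nat) :
  run x (s + t) = run x s ++ run (x + s%:R)%R t.
Proof.
rewrite /run /mkseq iotaD map_cat add0n -[in iota s t](addn0 s) iotaDl -map_comp.
by congr cat; apply: eq_map => i /=; rewrite natrD addrA.
Qed.

Lemma run_rcons (m : nat) (x : 'Z_m) (s : nat) :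
  run x s.+1 = run x s ++ [:: (x + s%:R)%R].
Proof. by rewrite -[s.+1]addn1 run_add {2}/run /mkseq /= addr0. Qed.

Lemma tm_suffix_run (m : nat) (w : seq 'Z_m) :
  tm_suffix w -> exists x s, s < m /\ w = run x s.
Proof.
case=> -[a /suffixP[p /esym pw]] ltw.
have sz : m = size p + size w by rewrite -size_cat pw size_mkseq.
exists (a + (size p)%:R)%R, (size w); split=> //.
have : p ++ w = run a (size p + size w) by rewrite -sz.
move/eqP; rewrite run_add.
by rewrite eqseq_cat ?size_mkseq // => /andP[_ /eqP].
Qed.

Lemma tm_prefix_run (m : nat) (w : seq 'Z_m) :
  tm_prefix w -> exists x s, s < m /\ w = run x s.
Proof.
case=> -[a /prefixP[p /esym pw]] ltw.
have sz : m = size w + size p by rewrite -size_cat pw size_mkseq.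
exists a, (size w); split=> //.
have : w ++ p = run a (size w + size p) by rewrite -sz.
move/eqP; rewrite run_add.
by rewrite eqseq_cat ?size_mkseq // => /andP[/eqP].
Qed.

Lemma val_Zp_succ (m : nat) (hm : 1 < m) (a : 'Z_m) :
  nat_of_ord (a + 1)%R = (nat_of_ord a).+1 %% m.
Proof.
by rewrite -[in LHS](natr_Zp a) natr1; apply: val_Zp_nat.
Qed.

Lemma eq_offset (m : nat) (hm : 1 < m) (x a : 'Z_m) (s : nat) (hs : s < m) :
  (x + s%:R == a)%R = (nat_of_ord (a - x)%R == s).
Proof.
rewrite -[in RHS](modn_small hs) -(val_Zp_nat hm) val_eqE.
by rewrite subr_eq addrC eq_sym.
Qed.

(** A run of at most m letters has no repetition, and a is its letter number
a - x, counted from 0. *)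
Lemma count_run (m : nat) (hm : 1 < m) (x a : 'Z_m) (s : nat) (hs : s <= m) :
  count_mem a (run x s) = (nat_of_ord (a - x)%R < s).
Proof.
elim: s hs => [|s IHs] hs; first by rewrite ltn0.
rewrite run_rcons count_cat (IHs (ltnW hs)) [count _ [:: _]]/= addn0 ltnS.
by rewrite eq_offset //; case: ltngtP.
Qed.

(** The letter a + 1 comes right after a in a run, except when the run begins
with a + 1: then a, if present, comes last and makes no pair. *)
Lemma subpairs_run_succ (m : nat) (hm : 1 < m) (x a : 'Z_m) (s : nat)
    (hs : s < m) :
  subpairs a (a + 1)%R (run x s.+1) = (nat_of_ord (a - x)%R < s).
Proof.
elim: s hs => [|s IHs] hs; first by rewrite /= muln0.
rewrite run_rcons subpairs_cat (IHs (ltnW hs)) count_run ?(ltnW hs) //.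
rewrite [subpairs _ _ [:: _]]/= [count _ [:: _]]/= muln0 !addn0 -natr1 addrA.
rewrite (inj_eq (addIr _)) eq_offset ?(ltnW hs) //.
by rewrite !ltnS; case: ltngtP.
Qed.

(** With fewer than m letters, a run that begins with a + 1 omits a, so that the
exceptional order a + 1 before a does not arise. *)
Lemma subpairs_run (m : nat) (hm : 1 < m) (x a : 'Z_m) (s : nat) (hs : s < m) :
  subpairs a (a + 1)%R (run x s)
  = count_mem a (run x s) * count_mem (a + 1)%R (run x s).
Proof.
case: s hs => [|s] // hs.
rewrite subpairs_run_succ ?(ltnW hs) // !count_run ?(ltnW hs) //.
rewrite addrAC val_Zp_succ //.
have := ltn_ord (a - x)%R; rewrite [X in _ < X]Zp_cast //.
move: (nat_of_ord (a - x)%R) => k; rewrite leq_eqVlt.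
case/orP=> [/eqP e|lt]; last by rewrite modn_small //; lia.
by rewrite e modnn; lia.
Qed.

Lemma subpairs_tm_letter (m : nat) (hm : 1 < m) (x a : 'Z_m) :
  subpairs a (a + 1)%R (tm_letter x) = (x != a + 1)%R.
Proof.
case: m hm x a => // m hm x a.
rewrite /tm_letter -/(run x m.+1) subpairs_run_succ //.
rewrite eq_sym -subr_eq0 addrAC -val_eqE.
rewrite -[X in _ = X]/(nat_of_bool (nat_of_ord (a - x + 1)%R != 0)) val_Zp_succ //.
have := ltn_ord (a - x)%R; rewrite [X in _ < X]Zp_cast //.
move: (nat_of_ord (a - x)%R) => k; rewrite leq_eqVlt.
case/orP=> [/eqP [->]|lt]; first by rewrite modnn ltnn.
by rewrite modn_small //; move: lt; rewrite ltnS => ->.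
Qed.

(** * Occurrences in images of the morphism *)

Lemma count_tm_morph (m : nat) (hm : 1 < m) (a : 'Z_m) (w : seq 'Z_m) :
  count_mem a (tm_morph w) = size w.
Proof.
elim: w => //= c w IHw.
rewrite /tm_morph /= count_cat -/(tm_morph w) IHw -/(run c m) count_run //.
by rewrite -[X in _ < X](Zp_cast hm) ltn_ord.
Qed.

(** Two distinct blocks contribute exactly one pair, as each of them contains each
letter once. *)
Lemma subpairs_tm_morph (m : nat) (hm : 1 < m) (a b : 'Z_m) (w : seq 'Z_m) :
  subpairs a b (tm_morph w)
  = \sum_(c <- w) subpairs a b (tm_letter c) + 'C(size w, 2).
Proof.
elim: w => [|c w IHw]; first by rewrite big_nil.
have -> : tm_morph (c :: w) = tm_letter c ++ tm_morph w by [].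
have := count_tm_morph hm a [:: c]; rewrite /tm_morph /= cats0 => ca.
rewrite subpairs_cat IHw count_tm_morph // ca big_cons /= binS bin1; lia.
Qed.

Lemma subpairs_succ_tm_morph (m : nat) (hm : 1 < m) (a : 'Z_m) (w : seq 'Z_m) :
  subpairs a (a + 1)%R (tm_morph w) + count_mem (a + 1)%R w
  = size w + 'C(size w, 2).
Proof.
rewrite subpairs_tm_morph // addnAC; congr addn.
rewrite (eq_bigr (fun c => nat_of_bool (predC (pred1 (a + 1)%R) c))); last first.
  by move=> c _; rewrite subpairs_tm_letter.
by rewrite -big_mkcond sum1_count addnC count_predC.
Qed.

(** * Recovering a run from its letters *)

Lemma Zp_const (m : nat) (T : Type) (f : 'Z_m -> T) :
  (forall a, f a = f (a + 1)%R) -> forall a b, f a = f b.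
Proof.
move=> fS a b.
have f0 n : f (n%:R)%R = f 0%R by elim: n => // n IHn; rewrite -natr1 -fS.
by rewrite -(natr_Zp a) -(natr_Zp b) !f0.
Qed.

Lemma val_opp1_succ (m : nat) (hm : 1 < m) : (nat_of_ord (- 1 : 'Z_m)%R).+1 = m.
Proof.
have := val_Zp_succ hm (- 1)%R; rewrite addNr => /esym/eqP.
have := ltn_ord (- 1 : 'Z_m)%R; rewrite [X in _ < X]Zp_cast //.
move: (nat_of_ord _) => k; rewrite leq_eqVlt => /orP[/eqP //|lt].
by rewrite modn_small.
Qed.

Lemma count_run_pred (m : nat) (hm : 1 < m) (x : 'Z_m) (s : nat) (hs : s < m) :
  count_mem (x - 1)%R (run x s) = 0.
Proof.
rewrite count_run ?(ltnW hs) // addrAC subrr add0r.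
by rewrite ltnNge -ltnS val_opp1_succ // hs.
Qed.

(** The starting letter is recognizable: it is the only letter of the run whose
predecessor is outside, which uses s < m. *)
Lemma run_inj (m : nat) (hm : 1 < m) (x x' : 'Z_m) (s s' : nat)
    (hs : s < m) (hs' : s' < m) :
  (forall a, count_mem a (run x s) = count_mem a (run x' s')) ->
  run x s = run x' s'.
Proof.
move=> e.
have pe : perm_eq (run x s) (run x' s').
  by apply/allP => a _ /=; apply/eqP/e.
have := perm_size pe; rewrite !size_mkseq => ss'; subst s'.
case: s hs hs' e {pe} => [//|s] hs _ e.
congr run; apply/eqP; rewrite -subr_eq0 -val_eqE.
rewrite -[X in is_true X]/(nat_of_ord (x - x')%R == 0).
have := e x; have := e (x - 1)%R.
rewrite count_run_pred // !count_run ?(ltnW hs) // subrr (addrAC x (- 1)%R).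
have -> : nat_of_ord (x - x')%R = (nat_of_ord (x - x' - 1)%R).+1 %% m.
  by rewrite -val_Zp_succ // subrK.
have := ltn_ord (x - x' - 1)%R; rewrite [X in _ < X]Zp_cast //.
move: (nat_of_ord (x - x' - 1)%R) => k; rewrite leq_eqVlt.
case/orP=> [/eqP->|lt]; first by rewrite modnn.
by rewrite modn_small //=; lia.
Qed.

(** The difference of the two letter counts is the same at all letters.  Evaluated
just before x it is at most 0, and just before x' it is at least 0, since the
respective runs omit these letters. *)
Lemma run_inj_step (m : nat) (hm : 1 < m) (x x' : 'Z_m) (s s' : nat)
    (hs : s < m) (hs' : s' < m) :
  (forall a, count_mem a (run x s) + count_mem (a + 1)%R (run x' s')
           = count_mem (a + 1)%R (run x s) + count_mem a (run x' s')) ->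
  run x s = run x' s'.
Proof.
move=> step.
pose f a : int := (Posz (count_mem a (run x s)) - Posz (count_mem a (run x' s')))%R.
have fc : forall a b, f a = f b.
  apply: Zp_const => a; rewrite /f; move: (step a).
  by do 4!move: (count_mem _ _) => ?; lia.
apply: run_inj => // a.
move: (fc a (x - 1)%R) (fc a (x' - 1)%R); rewrite /f !count_run_pred //.
by do 4!move: (count_mem _ _) => ?; lia.
Qed.

(** * Comparing two factorizations on adjacent letters *)

(** The booleans say whether a and a + 1 (suffix 1) belong to alpha and beta,
and p is the number of letters a + 1 in u'.  Put F = A - B - A' + B'.  If F drops
from a to a + 1, the equation between the pair counts forces n <= p; if F rises,
it forces n' <= p'.  Hence F is the same at both letters, as is
A + B - A' - B' = n' - n, and A - A' and B - B' follow by adding and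
subtracting. *)
Lemma adjacent_letters_agree (n n' p p' : nat) (A A1 B B1 A' A1' B' B1' : bool) :
  n + A + B = n' + A' + B' -> n + A1 + B1 = n' + A1' + B1' ->
  p < n -> p' < n' ->
  A * A1 + B * B1 + A * B1 + n * (A + B1) + (n - p) + 'C(n, 2)
  = A' * A1' + B' * B1' + A' * B1' + n' * (A' + B1') + (n' - p') + 'C(n', 2) ->
  A + A1' = A1 + A' /\ B + B1' = B1 + B'.
Proof.
move=> e e1 lp lp' eN.
(* The letter counts give |n - n'| <= 2, and at distance 2 all of A, B, A', B'
   are forced; so only equal or consecutive n and n' need the binomials. *)
have C1 : n = n'.+1 -> 'C(n, 2) = 'C(n', 2) + n' by move=> ->; rewrite binS bin1.
have C2 : n' = n.+1 -> 'C(n', 2) = 'C(n, 2) + n by move=> ->; rewrite binS bin1.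
have C0 : n = n' -> 'C(n, 2) = 'C(n', 2) by move=> ->.
move: 'C(n, 2) 'C(n', 2) C0 C1 C2 eN => C C' C0 C1 C2 eN.
case: A A1 B B1 A' A1' B' B1' e e1 eN => [] [] [] [] [] [] [] [] /=; lia.
Qed.

(** * Desubstitution in the Thue-Morse word *)

Lemma nth_tm_morph (m : nat) (w : seq 'Z_m) (q r : nat) :
  q < size w -> r < m ->
  nth 0%R (tm_morph w) (q * m + r) = (nth 0 w q + r%:R)%R.
Proof.
move=> + hr; elim: w q => // c w IHw [|q] hq.
  by rewrite /tm_morph /= nth_cat size_mkseq hr nth_mkseq.
rewrite /tm_morph /= nth_cat size_mkseq mulSn -addnA.
by rewrite ltnNge leq_addr /= addKn IHw.
Qed.

Lemma size_tm_morph (m : nat) (w : seq 'Z_m) : size (tm_morph w) = size w * m.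
Proof.
elim: w => //= c w IHw.
by rewrite /tm_morph /= size_cat size_mkseq -/(tm_morph w) IHw.
Qed.

Lemma size_iter_tm_morph (m n : nat) :
  size (iter n (@tm_morph m) [:: 0%R]) = m ^ n.
Proof.
by elim: n => // n IHn; rewrite iterS size_tm_morph IHn expnSr.
Qed.

Lemma nth_iter_tm_morphS (m k n : nat) (hm : 1 < m) : n < m ^ k ->
  nth 0%R (iter k.+1 (@tm_morph m) [:: 0%R]) n
  = nth 0%R (iter k (@tm_morph m) [:: 0%R]) n.
Proof.
elim: k n => [|k IHk] n hn.
  have -> : n = 0 by move: hn; rewrite expn0; case: n.
  by have /= := @nth_tm_morph m [:: 0%R] 0 0 isT (ltnW hm); rewrite add0r => ->.
have hr : n %% m < m by rewrite ltn_mod ltnW.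
have hq : n %/ m < m ^ k by rewrite ltn_divLR ?(ltnW hm) // -expnSr.
rewrite (divn_eq n m) iterS nth_tm_morph ?size_iter_tm_morph //; last first.
  by apply: leq_trans hq _; rewrite leq_pexp2l // ltnW.
by rewrite IHk // [in RHS]iterS nth_tm_morph ?size_iter_tm_morph.
Qed.

Lemma nth_iter_tm_morph (m k n : nat) (hm : 1 < m) : n <= k ->
  nth 0%R (iter k (@tm_morph m) [:: 0%R]) n = thue_morse m n.
Proof.
move=> /subnK <-; elim: (k - n) => // d IHd.
rewrite addSn nth_iter_tm_morphS //.
by apply: leq_trans (ltn_expl n hm) _; rewrite leq_pexp2l ?leq_addl // ltnW.
Qed.

(** The fixed-point equation of the infinite word, read letter by letter: letter r
of block q is the r-th successor of letter q. *)
Lemma thue_morse_decomp (m : nat) (hm : 1 < m) (q r : nat) (hr : r < m) :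
  thue_morse m (q * m + r) = (thue_morse m q + r%:R)%R.
Proof.
rewrite -(@nth_iter_tm_morph m (q * m + r).+1) // iterS.
have le : q <= q * m + r by nia.
rewrite nth_tm_morph ?size_iter_tm_morph ?nth_iter_tm_morph //.
by apply: leq_ltn_trans le (ltn_expl _ hm).
Qed.

Lemma thue_morse_succ (m : nat) (hm : 1 < m) (p : nat) : ~~ (m %| p.+1) ->
  thue_morse m p.+1 = (thue_morse m p + 1)%R.
Proof.
move=> nd; have m0 := ltnW hm.
have := ltn_pmod p.+1 m0; move: nd (divn_eq p.+1 m); rewrite /dvdn.
case: (p.+1 %% m) => // r _; move: (p.+1 %/ m) => q; rewrite addnS => -[->] hr.
rewrite -addnS !thue_morse_decomp // 1?ltnW //.
by rewrite -natr1 addrA.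
Qed.

(** If the successor rule also holds across the boundary between blocks p and
p + 1, then these two blocks start with the same letter, that is, letters p and
p + 1 are equal.  An interval of length 3m contains two consecutive boundaries,
and three consecutive equal letters contradict the successor rule inside a
block, as two of them lie in the same block. *)
Lemma thue_morse_no_long_run (m : nat) (hm : 1 < m) (k : nat) (b : 'Z_m) :
  ~ (forall j, j < 3 * m -> thue_morse m (k + j) = (b + j%:R)%R).
Proof.
move=> run3; have m0 := ltnW hm.
have rise p : k <= p -> p.+1 < k + 3 * m ->
    thue_morse m p.+1 = (thue_morse m p + 1)%R.
  move=> kp pk; rewrite -(subnKC kp) -addnS !run3; try lia.
  by rewrite -natr1 addrA.
have hk : k = k %/ m * m + k %% m := divn_eq k m.
have hr : k %% m < m by rewrite ltn_pmod.
move: (k %/ m) (k %% m) hk hr => q r hk hr.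
have boundary p : k < p.+1 * m -> p.+1 * m < k + 3 * m ->
    thue_morse m p.+1 = thue_morse m p.
  move=> lo hi; have := rise (p * m + m.-1).
  have -> : (p * m + m.-1).+1 = p.+1 * m + 0 by lia.
  rewrite !thue_morse_decomp ?prednK // addr0 => -> //; try lia.
  by rewrite -addrA natr1 prednK // pchar_Zp // addr0.
(* Position k lies in block q, so the two boundaries that follow it are those
   after the blocks q and q + 1. *)
have e1 : thue_morse m q.+1 = thue_morse m q by apply: boundary; lia.
have e2 : thue_morse m q.+2 = thue_morse m q.+1 by apply: boundary; lia.
have absurd p : thue_morse m p.+1 = thue_morse m p -> m %| p.+1.
  move=> e; apply/negPn/negP => /(thue_morse_succ hm)/eqP.
  by rewrite e -subr_eq0 opprD addNKr oppr_eq0 oner_eq0.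
have := dvdn_sub (absurd _ e2) (absurd _ e1).
by rewrite subSnn dvdn1 => /eqP m1; rewrite m1 in hm.
Qed.

(** A word w of equal letters b would put at least three copies of the block of b
next to each other in the Thue-Morse word, whatever the alignment of w with the
blocks of that word. *)
Lemma count_lt_size_of_factor (m : nat) (hm : 1 < m) (alpha beta w : seq 'Z_m)
    (b : 'Z_m) :
  tm_factor (alpha ++ tm_morph w ++ beta) -> 2 < size w ->
  count_mem b w < size w.
Proof.
case=> i fac w3; rewrite ltn_neqAle count_size andbT; apply/negP.
rewrite -all_count => /all_pred1P wb; have m0 := ltnW hm.
apply: (@thue_morse_no_long_run m hm (i + size alpha) b) => j hj.
have jw : j < size w * m by nia.
have := congr1 (fun u => nth 0%R u (size alpha + j)) fac.
rewrite /= nth_mkseq ?size_cat ?size_tm_morph; last by lia.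
rewrite nth_cat ltnNge leq_addr /= addKn nth_cat size_tm_morph jw addnA => <-.
have jq : j %/ m < size w by rewrite ltn_divLR.
rewrite [in LHS](divn_eq j m) nth_tm_morph ?ltn_pmod // [in nth _ w _]wb.
rewrite nth_nseq jq; congr (_ + _)%R.
by rewrite [in RHS](divn_eq j m) natrD natrM pchar_Zp // mulr0 add0r.
Qed.

(** * The characterization of 2-binomial equivalence *)

Lemma subpairs_decomp (m : nat) (hm : 1 < m) (alpha beta w : seq 'Z_m)
    (a : 'Z_m) (b := (a + 1)%R) :
  tm_suffix alpha -> tm_prefix beta ->
  subpairs a b (alpha ++ tm_morph w ++ beta)
  = count_mem a alpha * count_mem b alpha + count_mem a beta * count_mem b beta
    + count_mem a alpha * count_mem b beta
    + size w * (count_mem a alpha + count_mem b beta)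
    + (size w - count_mem b w) + 'C(size w, 2).
Proof.
case/tm_suffix_run=> x [s [hs ->]] /tm_prefix_run[y [t [ht ->]]].
rewrite !subpairs_cat !subpairs_run // count_cat !count_tm_morph //.
have := subpairs_succ_tm_morph hm a w; have := count_size (pred1 b) w.
rewrite /b; do 5!move: (count_mem _ _) => ?.
by move: (subpairs _ _ _) (size w) 'C(_, _); nia.
Qed.

Theorem theorem2 (m : nat) (hm : 3 <= m)
    (u v u' v' alpha beta alpha' beta' : seq 'Z_m)
    (hu : u = alpha ++ tm_morph u' ++ beta)
    (hv : v = alpha' ++ tm_morph v' ++ beta')
    (hfu : tm_factor u) (hfv : tm_factor v)
    (halpha : tm_suffix alpha) (hbeta : tm_prefix beta)
    (halpha' : tm_suffix alpha') (hbeta' : tm_prefix beta')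
    (hmin : 3 <= minn (size u') (size v')) :
  kbinom_eq 2 u v <-> (alpha = alpha' /\ beta = beta' /\ kbinom_eq 1 u' v').
Proof.
have hm1 : 1 < m by apply: ltnW.
move: hmin; rewrite leq_min => /andP[u3 v3].
rewrite kbinom_eq2E kbinom_eq1E; split; last first.
  case=> ea [eb pe]; subst alpha' beta' u v; have es := perm_size pe.
  split=> [a|a b]; first by rewrite !count_cat !count_tm_morph // es.
  rewrite !subpairs_cat !count_cat !count_tm_morph // es.
  by rewrite !subpairs_tm_morph // es (perm_big _ pe).
case=> e1 e2; subst u v.
have [x [s [hs es]]] := tm_suffix_run halpha.
have [y [t [ht et]]] := tm_prefix_run hbeta.
have [x' [s' [hs' es']]] := tm_suffix_run halpha'.
have [y' [t' [ht' et']]] := tm_prefix_run hbeta'.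
have c1 a : size u' + count_mem a alpha + count_mem a beta
          = size v' + count_mem a alpha' + count_mem a beta'.
  by have := e1 a; rewrite !count_cat !count_tm_morph //; lia.
have step a : count_mem a alpha + count_mem (a + 1)%R alpha'
              = count_mem (a + 1)%R alpha + count_mem a alpha'
           /\ count_mem a beta + count_mem (a + 1)%R beta'
              = count_mem (a + 1)%R beta + count_mem a beta'.
  have := e2 a (a + 1)%R; rewrite !subpairs_decomp //.
  have := c1 a; have := c1 (a + 1)%R.
  rewrite es et es' et' !count_run ?(ltnW hs) ?(ltnW ht) ?(ltnW hs') ?(ltnW ht') //.
  move=> cb ca; apply: adjacent_letters_agree => //.
    exact: count_lt_size_of_factor hfu u3.
  exact: count_lt_size_of_factor hfv v3.
have ea : alpha = alpha'.
  by rewrite es es'; apply: run_inj_step => // a; rewrite -es -es'; case: (step a).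
have eb : beta = beta'.
  by rewrite et et'; apply: run_inj_step => // a; rewrite -et -et'; case: (step a).
have sz : size u' = size v' by have := c1 0%R; rewrite -ea -eb => /addIn/addIn.
split=> //; split=> //.
apply/allP => b _ /=; apply/eqP.
have := e2 (b - 1)%R b; rewrite -ea -eb.
have := subpairs_decomp hm1 u' (b - 1)%R halpha hbeta.
have := subpairs_decomp hm1 v' (b - 1)%R halpha hbeta.
rewrite subrK sz => -> -> /addIn/addnI.
have := count_size (pred1 b) u'; have := count_size (pred1 b) v'; rewrite sz.
by move=> lev leu e; rewrite -(subKn leu) e subKn.
Qed.
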